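(* Let $m\ge 2$ and $r\ge 1$ be integers. Put \[ d=m+r-1,\qquad K_{m,r}=d+1-\left\lceil\frac dm\right\rceil,\qquad G_{m,r}:=\gcd_{1\le k\le K_{m,r}}B_{m,r,k}. \] For every prime $p\mid m$, set \[ a_p=v_p(m),\qquad q_p=\left\lfloor\frac{d-1}{p^{a_p}}\right\rfloor=\left\lceil\frac{d}{p^{a_p}}\right\rceil-1 . \] Then \[ G_{m,r}=\prod_{p\mid m}p^{\,a_p+v_p(q_p+1)-v_p(d)}, \] the product being over all primes $p$ dividing $m$. Equivalently, \[ G_{m,r}=\prod_{p\mid m}p^{\,v_p(m)+v_p\left(\left\lceil\frac{m+r-1}{p^{v_p(m)}}\right\rceil\right)-v_p(m+r-1)} . \] In particular, \[ \frac{m}{\gcd(m,r-1)}\ \Big|\ G_{m,r}. \]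
   Context: For an integer $d\ge 0$, $\binom{Y}{d}$ denotes the polynomial $Y(Y-1)\cdots(Y-d+1)/d!$. For integers $m\ge2$, $r\ge1$ and $d=m+r-1$, the shifted-binomial coordinates $B_{m,r,k}$ ($1\le k\le d+1$) are defined as the unique rational numbers satisfying the polynomial identity in $n$ \[ \binom{mn}{d}=\sum_{k=1}^{d+1}B_{m,r,k}\binom{n+k-1}{d} \] (the polynomials $\binom{n+k-1}{d}$, $1\le k\le d+1$, form a basis of the $\mathbb{Q}$-vector space of polynomials of degree at most $d$); the $B_{m,r,k}$ are in fact integers. $v_p$ denotes the $p$-adic valuation, the greatest common divisor is taken nonnegative, and $\gcd(m,0)=m$. *)

(* Defs.v *)
From mathcomp Require Import all_boot all_order all_algebra.
From mathcomp Require Import qpoly.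

Set Implicit Arguments.
Unset Strict Implicit.
Unset Printing Implicit Defensive.

Import Order.TTheory GRing.Theory Num.Theory.
Local Open Scope ring_scope.

(* Y (Y - 1) ... (Y - d + 1) / d! *)
Definition binom_poly (d : nat) : {poly rat} :=
  (d`!%:R)^-1 *: \prod_(i < d) ('X - (i%:R)%:P).

(* The entry of index i < d.+1 is binom(n + i, d), that is binom(n + k - 1, d)
   for k = i.+1. *)
Definition shifted_binomials (d : nat) : d.+1.-tuple {poly_d.+1 rat} :=
  [tuple npolyp d.+1 (binom_poly d \Po ('X + (i%:R)%:P)) | i < d.+1].

(* B_{m,r,k}, meaningful for 1 <= k <= d + 1, d = m + r - 1.  It is
   characterized by shifted_binomial_coordE and shifted_binomial_coord_unique
   below, and is an integer by shifted_binomial_coord_int. *)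
Definition shifted_binomial_coord (m r k : nat) : rat :=
  let d := (m + r - 1)%N in
  coord (shifted_binomials d) (inord k.-1)
    (npolyp d.+1 (binom_poly d \Po (m%:R *: 'X))).

(* The ceiling of a / b; as a / b >= 0, the absolute value is only a cast. *)
Definition ceil_divn (a b : nat) : nat := `|Num.ceil (a%:R / b%:R : rat)|%N.

Definition K_bound (m r : nat) : nat :=
  let d := (m + r - 1)%N in (d + 1 - ceil_divn d m)%N.

(* numq is harmless here: the coordinates are integers. *)
Definition G_gcd (m r : nat) : nat :=
  \big[gcdn/0%N]_(1 <= k < (K_bound m r).+1)
    `|numq (shifted_binomial_coord m r k)|%N.

Lemma horner_binom_poly d n : (binom_poly d).[n%:R] = 'C(n, d)%:R.
Proof.
rewrite /binom_poly hornerZ horner_prod.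
have [lt_nd|le_dn] := ltnP n d.
  rewrite bin_small // (bigD1 (Ordinal lt_nd)) //= hornerXsubC subrr mul0r.
  by rewrite mulr0.
have -> : \prod_(i < d) ('X - (i%:R)%:P).[n%:R] = (n ^_ d)%:R :> rat.
  rewrite ffact_prod natr_prod; apply: eq_bigr => i _.
  by rewrite hornerXsubC natrB // ltnW // (leq_trans (ltn_ord i)).
by rewrite -bin_ffact natrM mulrC mulfK // pnatr_eq0 -lt0n fact_gt0.
Qed.

Lemma size_binom_poly d : (size (binom_poly d) <= d.+1)%N.
Proof.
apply: leq_trans (size_scale_leq _ _) _.
by rewrite size_prod_XsubC /index_enum -enumT size_enum_ord.
Qed.

Lemma size_binom_comp d (q : {poly rat}) :
  (size q <= 2)%N -> (size (binom_poly d \Po q) <= d.+1)%N.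
Proof.
move=> sq; apply: leq_trans (size_comp_poly_leq _ _) _; rewrite ltnS.
apply: leq_trans (_ : d * 1 <= d)%N; last by rewrite muln1.
apply: leq_mul; first by have := size_binom_poly d; case: size.
by case: (size q) sq => // -[|[]].
Qed.

Lemma size_linear_shift (a : rat) : (size ('X + a%:P)%R <= 2)%N.
Proof. by rewrite size_XaddC. Qed.

Lemma size_linear_scale (a : rat) : (size (a *: 'X)%R <= 2)%N.
Proof. by apply: leq_trans (size_scale_leq _ _) _; rewrite size_polyX. Qed.

(* Evaluation at n = j gives a unitriangular system. *)
Lemma shifted_binomials_eval d (c : nat -> rat) (p : {poly rat}) j :
    \sum_(i < d.+1) c i *: (binom_poly d \Po ('X + (i%:R)%:P)) = p ->
    (j <= d)%N ->
  c (d - j)%N = p.[j%:R] - \sum_(i < j) c (d - i)%N * 'C(j + (d - i), d)%:R.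
Proof.
move=> <- le_jd; rewrite horner_sum.
under eq_bigr => i _ do
  rewrite hornerZ horner_comp hornerD hornerX hornerC -natrD horner_binom_poly.
rewrite (reindex_inj rev_ord_inj) /=.
under eq_bigr => i _ do rewrite subSS.
rewrite -(big_mkord xpredT (fun i => c (d - i)%N * 'C(j + (d - i), d)%:R)).
rewrite (big_cat_nat (n := j)) //=; last exact: leq_trans le_jd (leqnSn d).
rewrite big_mkord addrAC subrr add0r big_ltn ?ltnS //.
rewrite subnKC // binn mulr1 big_nat big1 ?addr0 // => i /andP[lt_ji lt_id].
rewrite bin_small ?mulr0 //.
rewrite ltnS in lt_id; rewrite addnBA // ltn_subLR; last first.
  exact: leq_trans lt_id (leq_addl _ _).
by rewrite ltn_add2r.
Qed.

Lemma shifted_binomialsE d (i : 'I_d.+1) :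
  (shifted_binomials d)`_i = binom_poly d \Po ('X + (i%:R)%:P) :> {poly rat}.
Proof.
rewrite -tnth_nth tnth_map tnth_ord_tuple npolypK //.
exact/size_binom_comp/size_linear_shift.
Qed.

Lemma sum_shifted_binomials d (c : 'I_d.+1 -> rat) :
  polyn (\sum_i c i *: (shifted_binomials d)`_i) =
  \sum_(i < d.+1) c i *: (binom_poly d \Po ('X + (i%:R)%:P)).
Proof.
rewrite raddf_sum /=; apply: eq_bigr => i _.
by rewrite -shifted_binomialsE.
Qed.

Lemma shifted_binomials_free d : free (shifted_binomials d).
Proof.
apply/freeP => u /(congr1 (@polyn _ _)); rewrite sum_shifted_binomials => u0.
pose c i := u (inord i).
have cE : \sum_(i < d.+1) c i *: (binom_poly d \Po ('X + (i%:R)%:P)) = 0.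
  by rewrite -[RHS]u0; apply: eq_bigr => i _; rewrite /c inord_val.
suff c0 j : (j <= d)%N -> c (d - j)%N = 0.
  move=> i; have := c0 (d - i)%N (leq_subr _ _).
  by rewrite subKn -1?ltnS // /c inord_val.
elim/ltn_ind: j => j IHj le_jd.
rewrite (shifted_binomials_eval cE) // horner0 sub0r big1 ?oppr0 // => i _.
by rewrite IHj ?mul0r // ltnW // (leq_trans _ le_jd).
Qed.

Lemma shifted_binomials_basis d : basis_of fullv (shifted_binomials d).
Proof.
by rewrite basisEfree shifted_binomials_free subvf dim_polyn size_tuple /=.
Qed.

Lemma shifted_binomial_coordE m r (d := (m + r - 1)%N) :
  binom_poly d \Po (m%:R *: 'X) =
  \sum_(1 <= k < d.+2) shifted_binomial_coord m r k *:
      (binom_poly d \Po ('X + (k.-1%:R)%:P)).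
Proof.
rewrite big_add1 big_mkord /=.
rewrite -[LHS](@npolypK _ d.+1) ?size_binom_comp ?size_linear_scale //.
rewrite [npolyp _ _ in LHS](coord_basis (shifted_binomials_basis d)) ?memvf //.
rewrite sum_shifted_binomials; apply: eq_bigr => i _.
by rewrite /shifted_binomial_coord /= -/d inord_val.
Qed.

Lemma shifted_binomial_coord_unique m r (d := (m + r - 1)%N) (c : nat -> rat) :
    binom_poly d \Po (m%:R *: 'X) =
    \sum_(1 <= k < d.+2) c k *: (binom_poly d \Po ('X + (k.-1%:R)%:P)) ->
  forall k, (1 <= k <= d.+1)%N -> c k = shifted_binomial_coord m r k.
Proof.
rewrite big_add1 big_mkord /= => cE [//|k] /= lt_kd; rewrite ltnS in lt_kd.
rewrite /shifted_binomial_coord /= -/d.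
have -> : npolyp d.+1 (binom_poly d \Po (m%:R *: 'X)) =
          \sum_(i < d.+1) c i.+1 *: (shifted_binomials d)`_i.
  apply: val_inj; rewrite /= sum_shifted_binomials npolypK ?cE //.
  by rewrite -cE size_binom_comp ?size_linear_scale.
by rewrite coord_sum_free ?shifted_binomials_free // inordK.
Qed.

Lemma shifted_binomial_coord_int m r k (d := (m + r - 1)%N) :
  (1 <= k <= d.+1)%N -> shifted_binomial_coord m r k \is a Num.int.
Proof.
case: k => // k /= le_kd; rewrite ltnS in le_kd.
pose c i := shifted_binomial_coord m r i.+1.
have := shifted_binomial_coordE m r.
rewrite /= -/d big_add1 big_mkord /= => /esym.
rewrite -/(c k) -(subKn le_kd) => cE.
elim/ltn_ind: (d - k)%N (leq_subr k d) => j IHj le_jd.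
rewrite (shifted_binomials_eval (c := c) cE) // horner_comp [(_ *: 'X).[_]]hornerZ hornerX.
rewrite -natrM horner_binom_poly rpredB ?rpred_nat // rpred_sum // => i _.
by rewrite rpredM ?rpred_nat // IHj // ltnW // (leq_trans _ le_jd).
Qed.

Lemma ceil_divnE a b : (0 < b)%N -> ceil_divn a b = ((a + b.-1) %/ b)%N.
Proof.
move=> b_gt0; rewrite /ceil_divn.
suff -> : Num.ceil (a%:R / b%:R : rat) = ((a + b.-1) %/ b)%N by [].
have b_gt0' : 0 < b%:R :> rat by rewrite ltr0n.
have := divn_eq (a + b.-1) b; have := ltn_pmod (a + b.-1) b_gt0.
set q := (_ %/ b)%N; set s := (_ %% b)%N => lt_sb eq_q.
have eq_q' : (a + b = q * b + s.+1)%N by rewrite addnS -eq_q -addnS prednK.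
apply: ceil_def; apply/andP; split.
  rewrite rmorphB /= rmorph1 ltrBlDr -ltrBlDr ltr_pdivlMr // mulrBl mul1r.
  by rewrite ltrBlDr -pmulrn -natrM -natrD ltr_nat eq_q' -addSnnS leq_addr.
rewrite ler_pdivrMr // -pmulrn -natrM ler_nat -(leq_add2r b) eq_q'.
by rewrite leq_add2l.
Qed.

(* Main.v *)
Require Import Defs.
From mathcomp Require Import all_boot all_order all_algebra.
From mathcomp Require Import zify.

Set Implicit Arguments.
Unset Strict Implicit.
Unset Printing Implicit Defensive.

Import Order.TTheory GRing.Theory Num.Theory.
Local Open Scope ring_scope.

(** The point is that the gcd of the coordinates B_k is the gcd of all the values
    C(mn, d), n >= 0.  Each such value is an integral combination of the B_k.
    Conversely, at n = j only the coordinates with k > d - j contribute, and the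
    one with k = d - j + 1 has coefficient C(d, d) = 1, so that the coordinates are
    integral combinations of the values (the system is unitriangular).
    Truncating the range of k at K is harmless because the values with mn < d
    vanish, which forces B_k = 0 for k > K ([dvdn_G_gcdP]).

    It remains to find, for each prime p, the minimum over n of v_p(C(mn, d)).
    Write m = p^a u with u prime to p, and q = (d - 1) / p^a rounded down.  From
      d C(mn, d) = mn C(mn - 1, d - 1)
    and the fact that the a lowest base-p digits of mn - 1 are all p - 1, so that
    subtracting d - 1 from it never borrows there, one gets
      v_p(C(mn - 1, d - 1)) = v_p(C(un - 1, q))     ([logn_bin_pred]).
    The first identity, applied once more to C(un, q + 1), gives
      v_p(C(mn, d)) + v_p(d) = a + v_p(q + 1) + v_p(C(un, q + 1))
    ([logn_bin_muln]).  The last term vanishes when un is congruent to q + 1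
    modulo a large power of p, which can be arranged since u is invertible there
    ([exists_logn_bin_muln]).  Hence v_p(G) = a + v_p(q + 1) - v_p(d), which is 0
    when p does not divide m, as then a = 0 and q + 1 = d.

    For the divisibility statement, m divides d C(mn, d), again by the first
    identity, so m / gcd(m, d) divides C(mn, d); and gcd(m, d) = gcd(m, r - 1)
    because d = m + (r - 1). *)

(** * The p-adic valuation of binomial coefficients *)

Section Valuation.
Local Open Scope nat_scope.

(** If p^L does not divide x, then v_p(x) < L can be read off from the
    divisibility of x by the powers of p up to p^L. *)
Lemma eq_logn_pfactor p L x y : prime p -> 0 < x -> 0 < y ->
    (forall k, k <= L -> (p ^ k %| x) = (p ^ k %| y)) -> ~~ (p ^ L %| x) ->
  logn p x = logn p y.
Proof.
move=> p_pr x_gt0 y_gt0 eq_xy ndvd_x.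
have ndvd_y : ~~ (p ^ L %| y) by rewrite -eq_xy.
move: ndvd_x ndvd_y; rewrite !pfactor_dvdn // -!ltnNge => lt_x lt_y.
apply/eqP; rewrite eqn_leq -!(pfactor_dvdn _ p_pr) //.
rewrite -eq_xy 1?ltnW // [X in _ && X]eq_xy 1?ltnW //.
by rewrite !pfactor_dvdn // !leqnn.
Qed.

Lemma logn_addr_pfactor p L x y : prime p -> 0 < y ->
  p ^ L %| x -> ~~ (p ^ L %| y) -> logn p (x + y) = logn p y.
Proof.
move=> p_pr y_gt0 dvd_x ndvd_y; apply/esym/(@eq_logn_pfactor _ L) => //.
  by rewrite addn_gt0 y_gt0 orbT.
by move=> k le_kL; rewrite dvdn_addr // (dvdn_trans _ dvd_x) // dvdn_exp2l.
Qed.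

Lemma logn_subr_pfactor p L x y : prime p -> 0 < y < x ->
  p ^ L %| x -> ~~ (p ^ L %| y) -> logn p (x - y) = logn p y.
Proof.
move=> p_pr /andP[y_gt0 lt_yx] dvd_x ndvd_y.
apply/esym/(@eq_logn_pfactor _ L); rewrite ?subn_gt0 //.
move=> k le_kL; rewrite dvdn_subr //; first exact: ltnW.
by rewrite (dvdn_trans _ dvd_x) // dvdn_exp2l.
Qed.

(** In C(PM - 1, D) = prod_(1 <= i <= D) (PM - i) / i, with P = p^a, the factors
    PM - i and i have the same valuation unless P divides i; the factors with
    i = P j contribute (M - j) / j, and they make up C(M - 1, D / P).  The
    induction on D adds these factors one at a time. *)
Lemma logn_bin_pred p a M D : prime p -> D < p ^ a * M ->
  logn p 'C((p ^ a * M).-1, D) = logn p 'C(M.-1, D %/ p ^ a).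
Proof.
move=> p_pr; set P := p ^ a.
have P_gt0 : 0 < P by rewrite expn_gt0 prime_gt0.
elim: D => [|D IHD] lt_D; first by rewrite div0n !bin0.
have bin_pos k N : k < N -> 0 < 'C(N.-1, k) by move=> ?; rewrite bin_gt0; lia.
have step := mul_bin_left (P * M).-1 D.
have {}step : logn p D.+1 + logn p 'C((P * M).-1, D.+1) =
    logn p (P * M - D.+1) + logn p 'C(M.-1, D %/ P).
  have lt_D' := ltnW lt_D.
  rewrite -IHD // -!lognM ?subn_gt0 ?bin_pos //.
  by rewrite step; congr (logn p (_ * _)); lia.
have [dvdPD | ndvdPD] := boolP (P %| D.+1); last first.
  rewrite divnS // (negbTE ndvdPD) add0n; apply/(@addnI (logn p D.+1)).
  rewrite step (@logn_subr_pfactor p a) // ?dvdn_mulr //.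
have {dvdPD}[j defD] : exists j, D.+1 = P * j.+1.
  case/dvdnP: dvdPD => -[|j]; first by lia.
  by exists j; rewrite mulnC.
have defj : D %/ P = j.
  by have := divnS D P_gt0; rewrite defD mulKn // dvdn_mulr // add1n => -[].
rewrite defD in lt_D step *; rewrite ltn_pmul2l // in lt_D.
rewrite mulKn // defj -mulnBr !lognM ?subn_gt0 // in step *.
have lt_jM := ltnW lt_D.
have := congr1 (logn p) (mul_bin_left M.-1 j).
rewrite !lognM ?bin_pos // ?subn_gt0; last by lia.
have -> : M.-1 - j = M - j.+1 by lia.
lia.
Qed.

(** In C(x + k, k) = prod_(1 <= i <= k) (x + i) / i, each i is smaller than p^L,
    hence x + i has the same valuation as i. *)
Lemma logn_bin_add_pfactor p L x k : prime p -> p ^ L %| x -> k < p ^ L ->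
  logn p 'C(x + k, k) = 0.
Proof.
move=> p_pr dvd_x; elim: k => [|k IHk] lt_k; first by rewrite bin0 logn1.
have := congr1 (logn p) (mul_bin_diag (x + k.+1) k).
rewrite addnS !lognM ?bin_gt0 ?leq_addl //=; last by rewrite -addnS leq_addl.
rewrite -addnS (@logn_addr_pfactor p L) ?IHk // 1?ltnW // ?addn0.
  by move=> e; apply/(@addnI (logn p k.+1)); rewrite -e addn0.
by apply/negP => /dvdn_leq-/(_ isT); rewrite leqNgt lt_k.
Qed.

(** As q does not depend on n, this isolates the dependence on n in the last
    binomial coefficient, and so bounds the valuation of C(mn, d) from below. *)
Lemma logn_bin_muln p m d n : prime p -> 0 < m -> 0 < d <= m * n ->
  let q := d.-1 %/ p ^ logn p m in
  logn p 'C(m * n, d) + logn p d =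
    logn p m + logn p q.+1 + logn p 'C(m %/ p ^ logn p m * n, q.+1).
Proof.
move=> p_pr m_gt0 /andP[d_gt0 le_d] q.
have [u co_pu def_m] := pfactor_coprime p_pr m_gt0.
set P := p ^ logn p m in q def_m *.
have P_gt0 : 0 < P by rewrite expn_gt0 prime_gt0.
have -> : m %/ P = u by rewrite [X in X %/ _]def_m mulnK.
have n_gt0 : 0 < n by lia.
have u_gt0 : 0 < u by lia.
have def_mn : m * n = P * (u * n) by rewrite mulnA (mulnC P) -def_m.
have lt_q : q < u * n by rewrite ltn_divLR // mulnC -def_mn; lia.
have lt_d : d.-1 < p ^ logn p m * (u * n) by rewrite -/P -def_mn; lia.
have logu : logn p u = 0 by apply: logn_coprime.
have key := logn_bin_pred p_pr lt_d; rewrite -/P -/q -def_mn in key.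
have := congr1 (logn p) (mul_bin_diag (m * n) d.-1).
rewrite prednK // !lognM ?bin_gt0 ?muln_gt0 ?m_gt0 // ?key; last by lia.
(* Absorbs the factor n left by the identity for C(m * n, d). *)
have := congr1 (logn p) (mul_bin_diag (u * n) q).
rewrite !lognM ?bin_gt0 ?muln_gt0 ?u_gt0 //; last by lia.
lia.
Qed.

(** The lower bound given by [logn_bin_muln] is attained: with u = m / p^a prime to
    p, the multiple un of u can be chosen congruent to q + 1 modulo a power of p
    larger than q + 1, so that p does not divide C(un, q + 1). *)
Lemma exists_logn_bin_muln p m d : prime p -> 0 < m -> 0 < d ->
  exists2 n, d <= m * n &
    logn p 'C(m * n, d) + logn p d =
      logn p m + logn p (d.-1 %/ p ^ logn p m).+1.
Proof.
move=> p_pr m_gt0 d_gt0; set q := _ %/ _.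
have [u co_pu def_m] := pfactor_coprime p_pr m_gt0.
have P_gt0 : 0 < p ^ logn p m by rewrite expn_gt0 prime_gt0.
have co_Lu : coprime (p ^ q.+1) u by rewrite coprimeXl.
(* Any exponent L with q.+1 < p ^ L would do in place of q.+1. *)
have lt_qL : q.+1 < p ^ q.+1 by apply/ltn_expl/prime_gt1.
pose x := chinese (p ^ q.+1) u q.+1 0.
have x_modL : x %% p ^ q.+1 = q.+1.
  by rewrite (chinese_modl co_Lu) modn_small.
have /dvdnP[n def_x] : u %| x by rewrite /dvdn (chinese_modr co_Lu) mod0n.
have le_qx : q < x by rewrite -x_modL leq_mod.
have le_d : d <= m * n.
  rewrite def_m mulnAC (mulnC u) -def_x.
  by have := ltn_ceil d.-1 P_gt0; rewrite -/q; nia.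
exists n => //; rewrite logn_bin_muln ?d_gt0 //= -/q.
have -> : m %/ p ^ logn p m = u by rewrite [X in X %/ _]def_m mulnK.
rewrite mulnC -def_x (divn_eq x (p ^ q.+1)) x_modL.
by rewrite (logn_bin_add_pfactor p_pr _ lt_qL) ?addn0 // dvdn_mull.
Qed.

End Valuation.

(** * The gcd of the coordinates as the gcd of the values *)

Lemma binomial_shifted_expansion m r n (d := (m + r - 1)%N) :
  'C(m * n, d)%:Z =
  \sum_(i < d.+1) numq (shifted_binomial_coord m r i.+1) * 'C(n + i, d)%:Z.
Proof.
apply: (@intr_inj rat); rewrite rmorph_sum /= -pmulrn.
have := congr1 (fun p => p.[n%:R]) (shifted_binomial_coordE m r).
rewrite /= -/d horner_comp [(_ *: 'X).[_]]hornerZ hornerX -natrM horner_binom_poly => ->.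
rewrite big_add1 big_mkord horner_sum; apply: eq_bigr => i _ /=.
rewrite hornerZ horner_comp hornerD hornerX hornerC -natrD horner_binom_poly.
by rewrite rmorphM /= numqK // shifted_binomial_coord_int //=; exact: ltn_ord.
Qed.

(** Forward substitution in the unitriangular system given by n = 0, ..., j.  The
    case g = 0, where divisibility means vanishing, is used as well, which is why
    only the values up to j are constrained. *)
Lemma dvdz_shifted_binomial_coord m r g j (d := (m + r - 1)%N) :
    (j <= d)%N -> (forall i, (i <= j)%N -> (g %| 'C(m * i, d))%N) ->
  (g %| numq (shifted_binomial_coord m r (d - j).+1))%Z.
Proof.
pose b i := numq (shifted_binomial_coord m r i.+1).
elim/ltn_ind: j => j IHj le_jd dvd_bin; rewrite -/(b (d - j)%N).
have -> : b (d - j)%N =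
    'C(m * j, d)%:Z - \sum_(i < j) b (d - i)%N * 'C(j + (d - i), d)%:Z.
  have coordE := esym (shifted_binomial_coordE m r).
  rewrite /= big_add1 big_mkord /= in coordE.
  have /= := shifted_binomials_eval
    (c := fun i => shifted_binomial_coord m r i.+1) coordE le_jd.
  rewrite -/d horner_comp [(_ *: 'X).[_]]hornerZ hornerX -natrM.
  rewrite horner_binom_poly => eq_coord; apply: (@intr_inj rat).
  rewrite numqK ?shifted_binomial_coord_int ?ltnS ?leq_subr // eq_coord.
  rewrite rmorphB rmorph_sum /=; congr (_ - _); apply: eq_bigr => i _.
  by rewrite rmorphM /= numqK // shifted_binomial_coord_int ?ltnS ?leq_subr.
rewrite rpredB //; first exact: dvd_bin.
apply: rpred_sum => i _; rewrite dvdz_mulr // IHj //.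
  exact: leq_trans (ltnW (ltn_ord i)) le_jd.
move=> l le_li; apply: dvd_bin; exact: leq_trans le_li (ltnW (ltn_ord i)).
Qed.

(** The coordinate of index d + 1 - j, with j < ceil(d / m), depends only on the
    values C(mi, d) with i <= j, and these vanish since mi < d. *)
Lemma shifted_binomial_coord_eq0 m r k (d := (m + r - 1)%N) : (0 < m)%N ->
  (K_bound m r <= k <= d)%N -> numq (shifted_binomial_coord m r k.+1) = 0.
Proof.
move=> m_gt0 /andP[le_Kk le_kd]; apply/eqP; rewrite -dvd0z -(subKn le_kd).
apply: dvdz_shifted_binomial_coord; first exact: leq_subr.
move=> i le_i; rewrite dvd0n; apply/eqP/bin_small.
have : (i < ceil_divn d m)%N by move: le_Kk; rewrite /K_bound -/d; lia.
rewrite ceil_divnE // -/d leq_divRL //; lia.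
Qed.

(** The gcd of the coordinates is characterized by the values C(mn, d) alone, which
    turns its study into that of the valuations of these values. *)
Lemma dvdn_G_gcdP m r g (d := (m + r - 1)%N) : (0 < m)%N ->
  reflect (forall n, (g %| 'C(m * n, d))%N) (g %| G_gcd m r)%N.
Proof.
move=> m_gt0.
have GE : G_gcd m r =
    \big[gcdn/0%N]_(k < K_bound m r) `|numq (shifted_binomial_coord m r k.+1)|%N.
  by rewrite /G_gcd big_add1 big_mkord.
rewrite GE; apply: (iffP (dvdn_biggcdP _ _ _)) => [dvd_coord n | dvd_bin k _].
  change (g%:Z %| 'C(m * n, d)%:Z)%Z.
  rewrite binomial_shifted_expansion; apply: rpred_sum => i _.
  rewrite dvdz_mulr //; have [le_Ki | lt_iK] := leqP (K_bound m r) i.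
    by rewrite shifted_binomial_coord_eq0 ?dvdz0 // le_Ki -ltnS /=.
  exact: dvd_coord (Ordinal lt_iK) isT.
change (g%:Z %| numq (shifted_binomial_coord m r k.+1))%Z.
have le_kd : (k <= d)%N.
  by rewrite -ltnS (leq_trans (ltn_ord k)) // /K_bound addn1 leq_subr.
rewrite -(subKn le_kd); apply: dvdz_shifted_binomial_coord => //.
exact: leq_subr.
Qed.

(** * The prime factorization of the gcd *)

Lemma prod_primes_logn m n : (0 < m)%N -> (0 < n)%N ->
    {subset primes n <= primes m} ->
  (\prod_(p <- primes m) p ^ logn p n)%N = n.
Proof.
move=> m_gt0 n_gt0 sub_nm.
have pi_n : \pi(m).-nat n.
  by apply/pnatP => // p p_pr p_dv; rewrite sub_nm // mem_primes p_pr n_gt0.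
rewrite -[RHS](part_pnat_id pi_n) (widen_partn _ (leq_maxl n m)).
rewrite -[RHS]big_filter; apply: perm_big; apply: uniq_perm => [||p].
- exact: primes_uniq.
- by rewrite filter_uniq // iota_uniq.
rewrite mem_filter mem_index_iota /=; apply/esym/andb_idr => p_m.
move: p_m; rewrite [_ \in _]mem_primes => /and3P[_ _ /dvdn_leq-/(_ m_gt0)].
by rewrite ltnS leq_max orbC => ->.
Qed.

Lemma G_gcd_dvd m r n : (0 < m)%N -> (G_gcd m r %| 'C(m * n, m + r - 1))%N.
Proof. by move=> m_gt0; move: n; apply/(dvdn_G_gcdP _ _ m_gt0). Qed.

Lemma G_gcd_gt0 m r : (0 < m)%N -> (0 < G_gcd m r)%N.
Proof.
move=> m_gt0; apply: dvdn_gt0 (G_gcd_dvd r (m + r - 1) m_gt0).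
by rewrite bin_gt0 leq_pmull.
Qed.

Lemma logn_G_gcd m r p (d := (m + r - 1)%N) : (0 < m)%N -> (0 < d)%N ->
    prime p ->
  (logn p (G_gcd m r) + logn p d =
     logn p m + logn p (d.-1 %/ p ^ logn p m).+1)%N.
Proof.
move=> m_gt0 d_gt0 p_pr; set q := (_ %/ _)%N.
have [n le_dn val_n] := exists_logn_bin_muln p_pr m_gt0 d_gt0.
rewrite -/q in val_n; set e := logn p 'C(m * n, d) in val_n.
apply/eqP; rewrite -val_n eqn_add2r eqn_leq dvdn_leq_log ?G_gcd_dvd //; last first.
  by rewrite bin_gt0.
rewrite -pfactor_dvdn ?G_gcd_gt0 //; apply/(dvdn_G_gcdP _ _ m_gt0) => k.
rewrite -/d; have [lt_kd | le_dk] := ltnP (m * k) d; first by rewrite bin_small.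
rewrite pfactor_dvdn ?bin_gt0 // -(leq_add2r (logn p d)) val_n.
by rewrite logn_bin_muln ?d_gt0 // leq_addr.
Qed.

Lemma divn_gcd_dvd_G_gcd m r : (0 < m)%N -> (0 < r)%N ->
  (m %/ gcdn m (r - 1) %| G_gcd m r)%N.
Proof.
move=> m_gt0 r_gt0; apply/(dvdn_G_gcdP _ _ m_gt0) => n.
set d := (m + r - 1)%N; have d_gt0 : (0 < d)%N by rewrite /d; lia.
have -> : gcdn m (r - 1) = gcdn m d by rewrite /d -addnBA // gcdnDl.
have g_gt0 : (0 < gcdn m d)%N by rewrite gcdn_gt0 m_gt0.
have co_md : coprime (m %/ gcdn m d) (d %/ gcdn m d).
  rewrite /coprime -(eqn_pmul2r g_gt0) mul1n muln_gcdl.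
  by rewrite !divnK ?dvdn_gcdl ?dvdn_gcdr.
rewrite -(Gauss_dvdr _ co_md) -(dvdn_pmul2r g_gt0) mulnAC.
rewrite !divnK ?dvdn_gcdl ?dvdn_gcdr //.
have := mul_bin_diag (m * n) d.-1; rewrite prednK // => <-.
by rewrite -mulnA dvdn_mulr.
Qed.

Theorem theorem5p6 (m r : nat) (hm : (2 <= m)%N) (hr : (1 <= r)%N) :
  let d := (m + r - 1)%N in
  let a := fun p : nat => logn p m in
  let q := fun p : nat => ((d - 1) %/ p ^ a p)%N in
  [/\ forall p : nat, p \in primes m -> (q p)%:Z = (ceil_divn d (p ^ a p))%:Z - 1,
      (G_gcd m r)%:R =
        \prod_(p <- primes m)
          (p%:R : rat) ^ ((a p)%:Z + (logn p (q p + 1))%:Z - (logn p d)%:Z),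
      (G_gcd m r)%:R =
        \prod_(p <- primes m)
          (p%:R : rat) ^ ((logn p m)%:Z
                          + (logn p (ceil_divn (m + r - 1) (p ^ logn p m)))%:Z
                          - (logn p (m + r - 1))%:Z)
    & (m %/ gcdn m (r - 1) %| G_gcd m r)%N].
Proof.
move=> d a q.
have m_gt0 : (0 < m)%N := ltnW hm.
have d_gt0 : (0 < d)%N by rewrite /d; lia.
have ceilE p : p \in primes m -> ceil_divn d (p ^ a p) = (q p).+1.
  rewrite mem_primes => /andP[p_pr _].
  have P_gt0 : (0 < p ^ a p)%N by rewrite expn_gt0 prime_gt0.
  rewrite ceil_divnE // /q -{1}(subnK d_gt0) -addnA add1n prednK //.
  by rewrite divnDr ?dvdnn // divnn P_gt0 addn1.
have GE : (G_gcd m r)%:R =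
    \prod_(p <- primes m)
      (p%:R : rat) ^ ((a p)%:Z + (logn p (q p + 1))%:Z - (logn p d)%:Z).
  rewrite -[in LHS](@prod_primes_logn m (G_gcd m r)) ?G_gcd_gt0 //; last first.
    (* A prime not dividing m does not divide G: there a p = 0 and q p + 1 = d. *)
    move=> p p_G; rewrite -logn_gt0; case: posnP => // logm0.
    have p_pr : prime p by move: p_G; rewrite mem_primes => /andP[].
    have := logn_G_gcd m_gt0 d_gt0 p_pr; rewrite logm0 expn0 divn1 prednK //.
    by move: p_G; rewrite -logn_gt0; lia.
  rewrite natr_prod; apply: eq_big_seq => p; rewrite mem_primes => /andP[p_pr _].
  rewrite natrX exprnP; congr (_ ^ _).
  have := logn_G_gcd m_gt0 d_gt0 p_pr; rewrite -/d -/(a p) -subn1 -/(q p).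
  rewrite addn1; lia.
split=> //; last exact: divn_gcd_dvd_G_gcd.
- by move=> p p_m; rewrite ceilE //; lia.
rewrite GE; apply: eq_big_seq => p p_m.
by rewrite -/d -/(a p) ceilE // addn1.
Qed.
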